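(* Let $\{\mathcal{R}_A\}$ be a zero-divisor functorial family with associated zero-divisor functor $\zeta$, let $A,B$ be rings, and let $\phi:\zeta(A\times B)\to\zeta(A)\times\zeta(B)$ be the canonical graph morphism. Then: 1. $\phi$ is a strong graph epimorphism; 2. if $\{\mathcal{R}_A\}$ also satisfies the property that, for all rings $A,B$, $$a\,\mathcal{R}_A\,a',\ b\,\mathcal{R}_B\,b'\ \Longrightarrow\ (a,b)\,\mathcal{R}_{A\times B}\,(a',b')\quad\text{for all } a,a'\in A \text{ and } b,b'\in B,$$ then $\phi$ is an isomorphism.
   Context: All rings are commutative and unitary and homomorphisms preserve $1$. A graph $G=(V(G),E(G))$ is a set $V(G)$ with a symmetric binary relation $E(G)$ on it (loops allowed). A graph morphism $G_1\to G_2$ is a map $V(G_1)\to V(G_2)$ sending adjacent pairs to adjacent pairs; it is strong if moreover two vertices are adjacent whenever their images are adjacent. A graph epimorphism is an epimorphism in the category $\mathbf{Graph}$ of graphs and graph morphisms, i.e. a morphism surjective on vertices. The product $G_1\times G_2$ has vertex set $V(G_1)\times V(G_2)$, with two pairs adjacent iff both their first components and their second components are adjacent; it is the categorical product in $\mathbf{Graph}$. An equivalence relation $\mathcal{R}$ on a ring $A$ is a zero-divisor relation if, whenever $a\,\mathcal{R}\,a'$ and $b\,\mathcal{R}\,b'$, $ab=0$ implies $a'b'=0$. A zero-divisor functorial family $\{\mathcal{R}_A\}$ is a choice, for each ring $A$, of a zero-divisor relation $\mathcal{R}_A$ on $A$ such that for every ring homomorphism $f:A\to B$, $a\,\mathcal{R}_A\,a'$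 implies $f(a)\,\mathcal{R}_B\,f(a')$. Its associated zero-divisor functor $\zeta:\mathbf{CRing}\to\mathbf{Graph}$ sends $A$ to the graph $\zeta(A)$ with vertex set $A/\mathcal{R}_A$ in which $[a],[b]$ are adjacent iff $ab=0$, and sends $f:A\to B$ to $\zeta(f):[a]\mapsto[f(a)]$. The canonical morphism $\phi$ is the unique graph morphism, given by the universal property of the product in $\mathbf{Graph}$, whose composites with the projections to $\zeta(A)$ and $\zeta(B)$ are the images under $\zeta$ of the ring projections $A\times B\to A$ and $A\times B\to B$. *)

(* Defs.v *)
From HB Require Import structures.
From Stdlib Require Import RelationClasses.
From mathcomp Require Import all_boot all_algebra.
From mathcomp Require Import boolp.

Set Implicit Arguments.
Unset Strict Implicit.
Unset Printing Implicit Defensive.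

Import GRing.Theory.
Local Open Scope ring_scope.
Local Open Scope quotient_scope.

Record graph := Graph {
  vertex :> Type;
  adj : vertex -> vertex -> Prop;
  adj_sym : forall x y, adj x y -> adj y x }.

Record graph_hom (G H : graph) := GraphHom {
  graph_fun :> G -> H;
  graph_homP : forall x y, adj x y -> adj (graph_fun x) (graph_fun y) }.

Definition graph_id (G : graph) : graph_hom G G :=
  @GraphHom G G id (fun _ _ => id).

Definition graph_comp (G H K : graph) (g : graph_hom H K) (f : graph_hom G H) :
  graph_hom G K :=
  @GraphHom G K (g \o f) (fun _ _ xy => graph_homP g (graph_homP f xy)).

Definition graph_strong (G H : graph) (f : graph_hom G H) : Prop :=
  forall x y, adj (f x) (f y) -> adj x y.

(* Graph morphisms are compared pointwise on vertices. *)
Definition graph_epi (G H : graph) (f : graph_hom G H) : Prop :=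
  forall (K : graph) (g h : graph_hom H K),
    graph_comp g f =1 graph_comp h f -> g =1 h.

Definition graph_iso (G H : graph) (f : graph_hom G H) : Prop :=
  exists g : graph_hom H G,
    graph_comp g f =1 graph_id G /\ graph_comp f g =1 graph_id H.

Lemma graph_epiP (G H : graph) (f : graph_hom G H) :
  graph_epi f <-> forall y, exists x, f x = y.
Proof.
split=> [epi_f y | surj_f K g h gh y]; last first.
  by have [x <-] := surj_f y; exact: gh.
pose K := @Graph Prop (fun _ _ => True) (fun _ _ => id).
pose g := @GraphHom H K (fun _ => True) (fun _ _ _ => I).
pose h := @GraphHom H K (fun z => exists x, f x = z) (fun _ _ _ => I).
have gh_y : g y = h y; last by rewrite -[exists x, _]/(h y) -gh_y.
apply: (epi_f K g h) => x /=.
by apply/propext; split=> // _; exists x.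
Qed.

Lemma graph_prod_sym (G H : graph) (p q : G * H) :
  adj p.1 q.1 /\ adj p.2 q.2 -> adj q.1 p.1 /\ adj q.2 p.2.
Proof. by case=> ? ?; split; apply: adj_sym. Qed.

Definition graph_prod (G H : graph) : graph :=
  @Graph (G * H)%type (fun p q => adj p.1 q.1 /\ adj p.2 q.2)
    (@graph_prod_sym G H).

Definition graph_fst (G H : graph) : graph_hom (graph_prod G H) G :=
  @GraphHom (graph_prod G H) G fst (fun _ _ => @proj1 _ _).

Definition graph_snd (G H : graph) : graph_hom (graph_prod G H) H :=
  @GraphHom (graph_prod G H) H snd (fun _ _ => @proj2 _ _).

Definition graph_pair (K G H : graph) (f : graph_hom K G) (g : graph_hom K H) :
  graph_hom K (graph_prod G H) :=
  @GraphHom K (graph_prod G H) (fun x => (f x, g x))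
    (fun _ _ xy => conj (graph_homP f xy) (graph_homP g xy)).

Lemma graph_prod_universal (K G H : graph) (f : graph_hom K G)
    (g : graph_hom K H) (p : graph_hom K (graph_prod G H)) :
  (graph_comp (graph_fst G H) p =1 f /\ graph_comp (graph_snd G H) p =1 g) <->
  p =1 graph_pair f g.
Proof.
split=> [[pf pg] x | pE]; last by split=> x /=; rewrite pE.
by have := pf x; have := pg x => /= <- <-; case: (p x).
Qed.

(* comPzRingType, unlike comNzRingType, includes the zero ring. *)
Definition zero_divisor_relation (A : comPzRingType) (R : A -> A -> Prop) :
  Prop :=
  Equivalence R /\
  forall a a' b b', R a a' -> R b b' -> a * b = 0 -> a' * b' = 0.

Record zd_family := ZDFamily {
  zd_rel :> forall A : comPzRingType, A -> A -> Prop;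
  zd_relP : forall A : comPzRingType, zero_divisor_relation (@zd_rel A);
  zd_rel_functorial :
    forall (A B : comPzRingType) (f : {rmorphism A -> B}) (a a' : A),
      zd_rel a a' -> zd_rel (f a) (f a') }.

Section ZeroDivisorFunctor.
Variable R : zd_family.
Implicit Types A B C : comPzRingType.

(* {eq_quot _} is built from a boolean relation. *)
Definition zd_relb A : rel A := fun a a' => `[< R A a a' >].
Arguments zd_relb : clear implicits.

Lemma zd_relb_refl A : reflexive (zd_relb A).
Proof. by move=> a; apply/asboolP; case: (zd_relP R A) => -[]. Qed.

Lemma zd_relb_sym A : symmetric (zd_relb A).
Proof.
have [[_ symR _] _] := zd_relP R A.
by move=> a a'; apply/asboolP/asboolP; exact: symR.
Qed.

Lemma zd_relb_trans A : transitive (zd_relb A).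
Proof.
have [[_ _ transR] _] := zd_relP R A.
by move=> b a c /asboolP ab /asboolP bc; apply/asboolP; exact: transR ab bc.
Qed.

Definition zd_equiv A : equiv_rel A :=
  EquivRel (zd_relb A) (@zd_relb_refl A) (@zd_relb_sym A) (@zd_relb_trans A).

Definition zd_quot A := {eq_quot (zd_equiv A)}.

Definition zd_class A (a : A) : zd_quot A := \pi_({eq_quot (zd_equiv A)}) a.

Lemma zd_classP A (a a' : A) : zd_class a = zd_class a' <-> R A a a'.
Proof.
split=> [/eqmodP /asboolP // | aa'].
by apply/eqmodP; apply/asboolP.
Qed.

Lemma zd_class_surj A (x : zd_quot A) : exists a, zd_class a = x.
Proof. by exists (repr x); exact: reprK. Qed.

Definition zd_adj A (x y : zd_quot A) : Prop :=
  exists a b : A, [/\ x = zd_class a, y = zd_class b & a * b = 0].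

Lemma zd_adj_sym A (x y : zd_quot A) : zd_adj x y -> zd_adj y x.
Proof. by case=> a [b [-> -> ab0]]; exists b, a; rewrite mulrC. Qed.

Lemma zd_adjE A (a b : A) : zd_adj (zd_class a) (zd_class b) <-> a * b = 0.
Proof.
split=> [[a' [b' [aa' bb' ab0]]] | ab0]; last by exists a, b.
have [_ zdR] := zd_relP R A.
by apply: zdR ab0; apply/zd_classP.
Qed.

Definition zeta A : graph := @Graph (zd_quot A) (@zd_adj A) (@zd_adj_sym A).

Definition zeta_fun A B (f : {rmorphism A -> B}) (x : zeta A) : zeta B :=
  zd_class (f (repr (x : {eq_quot (zd_equiv A)}))).

Lemma zeta_funE A B (f : {rmorphism A -> B}) (a : A) :
  zeta_fun f (zd_class a) = zd_class (f a).
Proof.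
apply/zd_classP; apply: zd_rel_functorial; apply/zd_classP.
exact: (reprK (zd_class a : {eq_quot (zd_equiv A)})).
Qed.

Lemma zeta_fun_hom A B (f : {rmorphism A -> B}) (x y : zeta A) :
  adj x y -> adj (zeta_fun f x) (zeta_fun f y).
Proof.
case=> a [b [-> -> ab0]]; rewrite !zeta_funE.
by apply/zd_adjE; rewrite -rmorphM ab0 rmorph0.
Qed.

Definition zeta_map A B (f : {rmorphism A -> B}) :
  graph_hom (zeta A) (zeta B) := GraphHom (@zeta_fun_hom A B f).

Lemma zeta_map_id A : zeta_map (idfun : {rmorphism A -> A}) =1 graph_id (zeta A).
Proof. by move=> x; have [a <-] := zd_class_surj x; rewrite /= zeta_funE. Qed.

Lemma zeta_map_comp A B C (g : {rmorphism B -> C}) (f : {rmorphism A -> B}) :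
  zeta_map (g \o f : {rmorphism A -> C}) =1
  graph_comp (zeta_map g) (zeta_map f).
Proof. by move=> x; have [a <-] := zd_class_surj x; rewrite /= !zeta_funE. Qed.

Definition canonical_morphism A B :
  graph_hom (zeta (A * B)%type) (graph_prod (zeta A) (zeta B)) :=
  graph_pair (zeta_map (fst : {rmorphism (A * B)%type -> A}))
             (zeta_map (snd : {rmorphism (A * B)%type -> B})).

End ZeroDivisorFunctor.

(* Main.v *)
Require Import Defs.
From mathcomp Require Import all_boot all_algebra.
From mathcomp Require Import boolp.

(** The two components of the canonical morphism come from the projections of
    A * B, so it sends the class of (a, b) to the class of a paired with the
    class of b ([canonical_morphismE]). Both halves of the proposition are read
    off this formula.

    It is onto because every pair of classes has a pair of representatives. It
    is strong because multiplication in A * B is componentwise: a product of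
    two pairs vanishes as soon as both component products do, and adjacency of
    classes can be tested on any representatives.

    For a strong morphism that is bijective on vertices, strength says that the
    inverse map preserves adjacency, so the morphism is an isomorphism
    ([strong_bijective_iso]). The second half is thereby reduced to injectivity
    on vertices, and by the formula this is the assumed compatibility of the
    family with the product A * B ([canonical_morphism_inj]). *)

Lemma strong_bijective_iso (G H : graph) (f : graph_hom G H) :
  graph_strong f -> graph_epi f -> injective f -> graph_iso f.
Proof.
move=> strong_f /graph_epiP surj_f inj_f.
have [g fK] := choice surj_f.
have g_hom x y : adj x y -> adj (g x) (g y).
  by move=> xy; apply: strong_f; rewrite !fK.
exists (GraphHom g_hom); split=> [x | y] /=; last exact: fK.
by apply: inj_f; rewrite fK.
Qed.

Section CanonicalMorphism.
Variables (R : zd_family) (A B : comPzRingType).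

Lemma canonical_morphismE (a : A) (b : B) :
  canonical_morphism R A B (zd_class R (a, b)) = (zd_class R a, zd_class R b).
Proof. by rewrite /= !zeta_funE. Qed.

(** Reduces claims about all vertices of zeta (A * B) to the classes of pairs,
    where [canonical_morphismE] computes the morphism. *)
Lemma zd_class_pair_surj (x : zeta R (A * B)%type) :
  exists a b, x = zd_class R (a, b).
Proof. by have [[a b] <-] := zd_class_surj x; exists a, b. Qed.

Lemma canonical_morphism_strong : graph_strong (canonical_morphism R A B).
Proof.
move=> x y.
have [a [b ->]] := zd_class_pair_surj x.
have [a' [b' ->]] := zd_class_pair_surj y.
rewrite !canonical_morphismE => -[/zd_adjE aa'0 /zd_adjE bb'0].
by apply/zd_adjE; congr pair.
Qed.

Lemma canonical_morphism_epi : graph_epi (canonical_morphism R A B).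
Proof.
apply/graph_epiP => -[x y].
have [a <-] := zd_class_surj x; have [b <-] := zd_class_surj y.
by exists (zd_class R (a, b)); exact: canonical_morphismE.
Qed.

Lemma canonical_morphism_inj :
  (forall (a a' : A) (b b' : B),
     R A a a' -> R B b b' -> R (A * B)%type (a, b) (a', b')) ->
  injective (canonical_morphism R A B).
Proof.
move=> R_pair x y.
have [a [b ->]] := zd_class_pair_surj x.
have [a' [b' ->]] := zd_class_pair_surj y.
rewrite !canonical_morphismE => -[/zd_classP aa' /zd_classP bb'].
by apply/zd_classP; exact: R_pair.
Qed.

End CanonicalMorphism.

Theorem proposition3p11 (R : zd_family) (A B : comPzRingType) :
  (graph_strong (canonical_morphism R A B) /\
   graph_epi (canonical_morphism R A B)) /\
  ((forall (A' B' : comPzRingType) (a a' : A') (b b' : B'),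
      R A' a a' -> R B' b b' -> R (A' * B')%type (a, b) (a', b')) ->
   graph_iso (canonical_morphism R A B)).
Proof.
have strong_phi := @canonical_morphism_strong R A B.
have epi_phi := @canonical_morphism_epi R A B.
split=> [// | R_pair].
apply: strong_bijective_iso => //.
by apply: canonical_morphism_inj; exact: R_pair.
Qed.
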